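(* For $k$ treated as a constant, the following problem (Problem 1) is solvable in $O(n^{2k-1}\log_2 n)$ time: given a triple of states $(|\psi\rangle,|\varphi\rangle,|\chi\rangle)$, where $|\psi\rangle$ and $|\varphi\rangle$ are $n\times n$ states with $\psi\prec\varphi$ and $|\chi\rangle$ is a $k\times k$ state, determine whether there exists a $k\times k$ state $|\omega\rangle$ such that $\psi\otimes\chi\prec\varphi\otimes\omega$, $\omega\prec\chi$, and $\chi\neq\omega$ (both in non-increasing order).
   Context: An $n\times n$ state is a bipartite pure state in $\mathbb{C}^n\otimes\mathbb{C}^n$, identified here with its Schmidt coefficient vector, a non-increasing $n$-dimensional probability vector: $|\psi\rangle=\sum_i\sqrt{\alpha_i}|i_A\rangle|i_B\rangle$ has $\psi=(\alpha_1,\dots,\alpha_n)$. $\psi\otimes\chi$ is the Kronecker product of vectors. For vectors of the same dimension $N$, $x\prec y$ means that for each $1\le l<N$ the sum of the $l$ largest components of $x$ is at most that of $y$, with equality of the total sums. Input is given by the Schmidt coefficient vectors, and time counts arithmetic operations and comparisons on real numbers, each at unit cost. *)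

(* Defs.v *)
From mathcomp Require Import all_boot all_order all_algebra.
From mathcomp Require Export mxtens.
From mathcomp Require Import all_classical all_reals all_analysis.

Set Implicit Arguments.
Unset Strict Implicit.
Unset Printing Implicit Defensive.

Import Order.TTheory GRing.Theory Num.Theory numFieldNormedType.Exports.
Local Open Scope ring_scope.

Section Majorization.
Variable R : realType.

Definition entries n (x : 'rV[R]_n) : seq R :=
  [seq x ord0 i | i <- enum 'I_n].

(* An n x n state is identified with its Schmidt coefficient vector, a
   non-increasing probability vector; zero coefficients are allowed. *)
Definition is_state n (x : 'rV[R]_n) : Prop :=
  [/\ forall i, 0 <= x ord0 i,
      \sum_i x ord0 i = 1 &
      forall i j : 'I_n, (i <= j)%N -> x ord0 j <= x ord0 i].

Definition sum_largest n (l : nat) (x : 'rV[R]_n) : R :=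
  \sum_(a <- take l (sort >=%R (entries x))) a.

Definition majorized n (x y : 'rV[R]_n) : Prop :=
  (forall l : nat, (1 <= l < n)%N -> sum_largest l x <= sum_largest l y) /\
  \sum_i x ord0 i = \sum_i y ord0 i.

(* [_ *t _] is the Kronecker product; on row vectors it has type
   'rV_(n * k), since 1 * 1 computes to 1. *)
Definition kron n k (x : 'rV[R]_n) (y : 'rV[R]_k) : 'rV[R]_(n * k) := x *t y.

Definition recoverable n k (psi phi : 'rV[R]_n) (chi : 'rV[R]_k) : Prop :=
  exists omega : 'rV[R]_k,
    [/\ is_state omega,
        majorized (kron psi chi) (kron phi omega),
        majorized omega chi &
        chi <> omega].

End Majorization.

(** * The real RAM

   Programs act on two memories, one of natural numbers (used for indices and
   counters) and one of reals. Each memory consists of arrays of unbounded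
   length, numbered by naturals; array numbers are literals in the program
   text, positions inside an array are computed at run time. Programs are
   finite and contain only natural-number literals, so a single program has to
   deal with inputs of all sizes, and information about the real data can only
   be obtained through comparisons. *)

Inductive iexp : Type :=
| IConst of nat
| ILoad of nat & iexp
| IAdd of iexp & iexp
| ISub of iexp & iexp
| IMul of iexp & iexp.

Inductive rexp : Type :=
| RConst of nat
| RLoad of nat & iexp
| RAdd of rexp & rexp
| RSub of rexp & rexp
| RMul of rexp & rexp
| RDiv of rexp & rexp.

Inductive bexp : Type :=
| BLeI of iexp & iexp
| BLeR of rexp & rexp
| BNot of bexp
| BAnd of bexp & bexp.

Inductive cmd : Type :=
| Skip
| IStore of nat & iexp & iexp
| RStore of nat & iexp & rexp
| Seq of cmd & cmd
| If of bexp & cmd & cmd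
| While of bexp & cmd.

(* Every constant, memory access, arithmetic operation and comparison has
   unit cost, whether it concerns reals or indices. *)
Fixpoint icost (e : iexp) : nat :=
  match e with
  | IConst _ => 1
  | ILoad _ e1 => (icost e1).+1
  | IAdd e1 e2 | ISub e1 e2 | IMul e1 e2 => (icost e1 + icost e2).+1
  end%N.

Fixpoint rcost (e : rexp) : nat :=
  match e with
  | RConst _ => 1
  | RLoad _ e1 => (icost e1).+1
  | RAdd e1 e2 | RSub e1 e2 | RMul e1 e2 | RDiv e1 e2 =>
      (rcost e1 + rcost e2).+1
  end%N.

Fixpoint bcost (b : bexp) : nat :=
  match b with
  | BLeI e1 e2 => (icost e1 + icost e2).+1
  | BLeR e1 e2 => (rcost e1 + rcost e2).+1
  | BNot b1 => (bcost b1).+1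
  | BAnd b1 b2 => (bcost b1 + bcost b2).+1
  end%N.

Section Semantics.
Variable R : realType.

Record store : Type := Store {
  imem : nat -> nat -> nat;
  rmem : nat -> nat -> R
}.

(* Subtraction of naturals is truncated. *)
Fixpoint ieval (s : store) (e : iexp) : nat :=
  match e with
  | IConst c => c
  | ILoad a e1 => imem s a (ieval s e1)
  | IAdd e1 e2 => ieval s e1 + ieval s e2
  | ISub e1 e2 => ieval s e1 - ieval s e2
  | IMul e1 e2 => ieval s e1 * ieval s e2
  end%N.

(* Division by 0 yields 0. *)
Fixpoint reval (s : store) (e : rexp) : R :=
  match e with
  | RConst c => c%:R
  | RLoad a e1 => rmem s a (ieval s e1)
  | RAdd e1 e2 => reval s e1 + reval s e2
  | RSub e1 e2 => reval s e1 - reval s e2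
  | RMul e1 e2 => reval s e1 * reval s e2
  | RDiv e1 e2 => reval s e1 / reval s e2
  end.

Fixpoint beval (s : store) (b : bexp) : bool :=
  match b with
  | BLeI e1 e2 => (ieval s e1 <= ieval s e2)%N
  | BLeR e1 e2 => reval s e1 <= reval s e2
  | BNot b1 => ~~ beval s b1
  | BAnd b1 b2 => beval s b1 && beval s b2
  end.

Definition update (V : Type) (m : nat -> nat -> V) (a p : nat) (v : V) :
    nat -> nat -> V :=
  fun a' p' => if (a' == a) && (p' == p) then v else m a' p'.

(* [run s c t s']: started in [s], the program [c] halts in [s'] after
   [t] unit-cost steps. *)
Inductive run : store -> cmd -> nat -> store -> Prop :=
| RunSkip s : run s Skip 1 s
| RunIStore s a p e :
    run s (IStore a p e) (icost p + icost e).+1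
      (Store (update (imem s) a (ieval s p) (ieval s e)) (rmem s))
| RunRStore s a p e :
    run s (RStore a p e) (icost p + rcost e).+1
      (Store (imem s) (update (rmem s) a (ieval s p) (reval s e)))
| RunSeq s1 s2 s3 c1 c2 t1 t2 :
    run s1 c1 t1 s2 -> run s2 c2 t2 s3 -> run s1 (Seq c1 c2) (t1 + t2) s3
| RunIf s s' b c1 c2 t :
    run s (if beval s b then c1 else c2) t s' ->
    run s (If b c1 c2) (bcost b + t) s'
| RunWhileEnd s b c :
    ~~ beval s b -> run s (While b c) (bcost b) s
| RunWhileLoop s1 s2 s3 b c t1 t2 :
    beval s1 b -> run s1 c t1 s2 -> run s2 (While b c) t2 s3 ->
    run s1 (While b c) (bcost b + t1 + t2) s3.

(* The size [n] is at position 0 of integer array 0; psi, phi and chi are in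
   the real arrays 0, 1 and 2; everything else is 0. *)
Definition input n k (psi phi : 'rV[R]_n) (chi : 'rV[R]_k) : store :=
  Store (fun a p => if (a == 0) && (p == 0) then n else 0)%N
        (fun a p => match a with
                    | 0%N => nth 0 (entries psi) p
                    | 1%N => nth 0 (entries phi) p
                    | 2%N => nth 0 (entries chi) p
                    | _ => 0
                    end).

(* The answer is "yes" iff integer array 0 holds a nonzero value at
   position 0 on halting. *)
Definition answer (s : store) : bool := imem s 0 0 != 0%N.

(* The inputs are restricted by a promise, and the program must be right and
   halt on all of them. [T n] bounds its time over all real inputs of size n. *)
Definition decides_recovery (k : nat) (c : cmd) (T : nat -> nat) : Prop :=
  forall (n : nat) (psi phi : 'rV[R]_n) (chi : 'rV[R]_k),
    is_state psi -> is_state phi -> is_state chi -> majorized psi phi ->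
    exists (t : nat) (s : store),
      [/\ run (input psi phi chi) c t s,
          (t <= T n)%N &
          answer s <-> recoverable psi phi chi].

Definition log2 (x : R) : R := ln x / ln 2.

End Semantics.

(* Main.v *)
(* Recoverability is a local property at [chi]. If [omega] is a witness, so is
   every sorted [omega'] with [omega] < [omega'] < [chi] in the majorization
   order, because tensoring with [phi] preserves majorization. For all small
   [e > 0], the vectors that arise from [chi] by moving mass [e] from some
   position [a] to [a + 1] at a strict descent of [chi] are of this kind. So
   only [k - 1] directions have to be examined, each for infinitesimal [e].

   Majorization of [x] by [y] amounts to equality of the sums and
   [\sum_i max (x_i - t) 0 <= \sum_i max (y_i - t) 0] at every entry [t] of [y].
   For infinitesimal [e] each such comparison is the lexicographic comparison
   of a pair (value, derivative), obtained by adding up [n * k] terms. This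
   gives time O(n^2) for [k >= 2], and O(1) for [k = 1]. *)

Require Import Defs.
From mathcomp Require Import all_boot all_order all_algebra.
From mathcomp Require Import all_classical all_reals all_analysis.
From mathcomp Require Import ring lra zify.
Import Order.TTheory GRing.Theory Num.Theory numFieldNormedType.Exports.
Local Open Scope classical_set_scope.
Local Open Scope ring_scope.

Set Implicit Arguments.
Unset Strict Implicit.
Unset Printing Implicit Defensive.

(** * Majorization through excesses over thresholds *)

Section Majorization.
Variable R : realType.

(** Sums of positive parts describe majorization without sorting, so they can be evaluated term by
    term and expanded in a perturbation. *)
Definition excess n (x : 'rV[R]_n) (t : R) : R :=
  \sum_i Num.max (x ord0 i - t) 0.

Lemma sum_take_sub (s : seq R) l t : (l <= size s)%N ->
  \sum_(a <- take l s) a - l%:R * t = \sum_(a <- take l s) (a - t).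
Proof.
move=> ls; rewrite sumrB big_const_seq count_predT size_takel//.
by rewrite iter_addr_0 mulr_natl.
Qed.

Lemma sum_take_le_excess (s : seq R) l t : (l <= size s)%N ->
  \sum_(a <- take l s) a - l%:R * t <= \sum_(a <- s) Num.max (a - t) 0.
Proof.
move=> ls; rewrite sum_take_sub// -[in leRHS](cat_take_drop l s) big_cat/=.
rewrite -[leLHS]addr0 lerD//; last first.
  by apply: sumr_ge0 => a _; rewrite le_max lexx orbT.
by apply: ler_sum => a _; rewrite le_max lexx.
Qed.

(** The prefix bound is attained when [t] separates the prefix from the rest: the positive parts are
    plain differences inside the prefix and vanish outside. *)
Lemma sum_take_eq_excess (s : seq R) l t : (l <= size s)%N ->
  all (fun a => t <= a) (take l s) -> all (fun a => a <= t) (drop l s) ->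
  \sum_(a <- take l s) a - l%:R * t = \sum_(a <- s) Num.max (a - t) 0.
Proof.
move=> ls /allP hi /allP lo.
rewrite sum_take_sub// -[in RHS](cat_take_drop l s) big_cat/=.
rewrite [X in _ + X]big1_seq ?addr0; last first.
  by move=> a /andP[_ /lo at0]; apply/max_idPr; rewrite subr_le0.
by apply: eq_big_seq => a /hi ta; apply/esym/max_idPl; rewrite subr_ge0.
Qed.

Lemma sorted_split_count (s : seq R) t : sorted >=%R s ->
  all (fun a => t <= a) (take (count (> t) s) s) /\
  all (fun a => a <= t) (drop (count (> t) s) s).
Proof.
elim: s => [//|a s IH] /= as_; have ss := path_sorted as_.
have [ta|at_] := ltP t a; first by rewrite add1n /= (ltW ta); exact: IH.
have le_a : all (fun b => b <= a) s.
  by move: as_; rewrite (path_sortedE (rev_trans le_trans)) => /andP[].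
rewrite add0n.
have -> : count (> t) s = 0%N.
  apply/eqP; rewrite -leqn0 leqNgt -has_count -all_predC.
  apply/allP => b /(allP le_a) ba /=; rewrite -leNgt; exact: le_trans at_.
rewrite take0 drop0 /= at_; split=> //.
by apply/allP => b /(allP le_a) ba; exact: le_trans at_.
Qed.

Lemma sorted_split_nth (s : seq R) l : (0 < l <= size s)%N -> sorted >=%R s ->
  all (fun a => nth 0 s l.-1 <= a) (take l s) /\
  all (fun a => a <= nth 0 s l.-1) (drop l s).
Proof.
case/andP=> l0 ls ss.
have mono := sorted_leq_nth (rev_trans le_trans) (@lexx _ R) 0 ss.
split; apply/(all_nthP 0) => i.
  rewrite size_takel// => il; rewrite nth_take//.
  by apply: mono; rewrite ?inE/=; lia.
rewrite size_drop nth_drop => il; apply: mono;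
  rewrite ?inE/= ?prednK -?ltn_subRL//.
exact: leq_trans (leq_pred _) (leq_addr _ _).
Qed.

Lemma size_entries n (x : 'rV[R]_n) : size (entries x) = n.
Proof. by rewrite size_map size_enum_ord. Qed.

Lemma nth_entries n (x : 'rV[R]_n) (i : 'I_n) : nth 0 (entries x) i = x ord0 i.
Proof.
by rewrite (nth_map i) ?size_enum_ord// nth_ord_enum.
Qed.

Lemma sum_entries n (x : 'rV[R]_n) (F : R -> R) :
  \sum_(a <- entries x) F a = \sum_i F (x ord0 i).
Proof. by rewrite big_map big_enum. Qed.

Lemma excess_sort n (x : 'rV[R]_n) t :
  excess x t = \sum_(a <- sort >=%R (entries x)) Num.max (a - t) 0.
Proof.
by rewrite (perm_big (entries x)) ?perm_sort// sum_entries.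
Qed.

Lemma sum_largest_all n (x : 'rV[R]_n) : sum_largest n x = \sum_i x ord0 i.
Proof.
rewrite /sum_largest take_oversize ?size_sort ?size_entries//.
by rewrite (perm_big (entries x)) ?perm_sort// (sum_entries x id).
Qed.

Lemma sum_largest_excess_le n (x : 'rV[R]_n) l t : (l <= n)%N ->
  sum_largest l x - l%:R * t <= excess x t.
Proof.
by move=> ln; rewrite excess_sort sum_take_le_excess// size_sort size_entries.
Qed.

Lemma sorted_sort_entries n (x : 'rV[R]_n) :
  sorted >=%R (sort >=%R (entries x)).
Proof. by apply: sort_sorted => a b; exact: le_total. Qed.

(** The [l]-th largest entry separates the [l] largest from the rest, so the bound of
    [sum_largest_excess_le] is attained there. *)
Lemma sum_largest_excess n (x : 'rV[R]_n) l : (0 < l <= n)%N ->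
  exists i, sum_largest l x - l%:R * x ord0 i = excess x (x ord0 i).
Proof.
move=> ln; set s := sort >=%R (entries x).
have sz : size s = n by rewrite size_sort size_entries.
have : nth 0 s l.-1 \in entries x.
  by rewrite -(perm_mem (permEl (perm_sort >=%R _))) mem_nth// sz; lia.
case/mapP => i _ xi; exists i; rewrite -xi excess_sort.
have [hi lo] : all (fun a => nth 0 s l.-1 <= a) (take l s) /\
  all (fun a => a <= nth 0 s l.-1) (drop l s).
  by apply: sorted_split_nth; [rewrite sz|exact: sorted_sort_entries].
by rewrite -(sum_take_eq_excess _ hi lo)// sz; case/andP: ln.
Qed.

(** Dually, for fixed [t] the bound is attained when [l] counts the entries above [t]. *)
Lemma excess_sum_largest n (x : 'rV[R]_n) t :
  exists2 l, (l <= n)%N & excess x t = sum_largest l x - l%:R * t.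
Proof.
set s := sort >=%R (entries x).
have sz : size s = n by rewrite size_sort size_entries.
have [hi lo] := sorted_split_count t (sorted_sort_entries x).
exists (count (> t) s); first by rewrite -sz count_size.
by rewrite excess_sort -(sum_take_eq_excess _ hi lo)// count_size.
Qed.

(** Only [y] has to attain the bound, and it does so at its own entries; for [x] the inequality
    suffices. Hence finitely many thresholds are enough. *)
Lemma majorized_of_excess n (x y : 'rV[R]_n) :
  \sum_i x ord0 i = \sum_i y ord0 i ->
  (forall i, excess x (y ord0 i) <= excess y (y ord0 i)) -> majorized x y.
Proof.
move=> xy le_xy; split=> // l /andP[l0 ln].
have [|i yi] := @sum_largest_excess _ y l; first by rewrite l0 ltnW.
rewrite -(lerD2r (- (l%:R * y ord0 i))) yi.
exact: le_trans (sum_largest_excess_le _ _ (ltnW ln)) (le_xy i).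
Qed.

Lemma excess_of_majorized n (x y : 'rV[R]_n) t :
  majorized x y -> excess x t <= excess y t.
Proof.
move=> [le_xy xy]; have [l ln ->] := excess_sum_largest x t.
apply: le_trans (sum_largest_excess_le y t ln); rewrite lerD2r.
(* The lengths 0 and [n] lie outside the range in [majorized]; they follow from the empty sum and
   the equal totals. *)
have [->|l0] := eqVneq l 0%N; first by rewrite /sum_largest !take0.
have [->|ln'] := eqVneq l n; first by rewrite !sum_largest_all xy.
by apply: le_xy; lia.
Qed.


Lemma majorized_trans n (y x z : 'rV[R]_n) :
  majorized x y -> majorized y z -> majorized x z.
Proof.
move=> [xy sxy] [yz syz]; split=> [l ln|]; last by rewrite sxy.
exact: le_trans (xy l ln) (yz l ln).
Qed.

Lemma sum_kron n k (x : 'rV[R]_n) (y : 'rV[R]_k) (F : R -> R) :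
  \sum_i F (kron x y ord0 i) = \sum_i \sum_b F (x ord0 i * y ord0 b).
Proof.
rewrite pair_big/= (reindex (@mxtens_index n k)); last first.
  by exists (@mxtens_unindex n k) => i _;
    rewrite ?mxtens_indexK ?mxtens_unindexK.
apply: eq_bigr => -[i b] _; congr F.
rewrite /kron -tensmxE; congr (_ _ _); exact: val_inj.
Qed.

Lemma kron_entry n k (x : 'rV[R]_n) (y : 'rV[R]_k) j :
  exists i b, kron x y ord0 j = x ord0 i * y ord0 b.
Proof.
case: (mxtens_indexP j) => i b; exists i, b.
rewrite /kron -tensmxE; congr (_ _ _); exact: val_inj.
Qed.

(** Factoring out a positive entry of [x] turns its terms into an excess of the second factor at a
    rescaled threshold; zero entries contribute equally on both sides. *)
Lemma majorized_kron n k (x : 'rV[R]_n) (y z : 'rV[R]_k) :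
  (forall i, 0 <= x ord0 i) -> majorized y z ->
  majorized (kron x y) (kron x z).
Proof.
move=> x0 yz; apply: majorized_of_excess.
  rewrite (sum_kron x y id) (sum_kron x z id); apply: eq_bigr => i _.
  by rewrite -!mulr_sumr yz.2.
move=> j; move: (kron x z ord0 j) => t.
rewrite /excess (sum_kron x y (fun a => Num.max (a - t) 0)).
rewrite (sum_kron x z (fun a => Num.max (a - t) 0)); apply: ler_sum => i _.
have [xi0|xi0] := eqVneq (x ord0 i) 0.
  by apply: ler_sum => b _; rewrite xi0 !mul0r.
have xi : 0 < x ord0 i by rewrite lt_def xi0 x0.
have E (w : 'rV[R]_k) : \sum_b Num.max (x ord0 i * w ord0 b - t) 0 =
    x ord0 i * excess w (t / x ord0 i).
  rewrite mulr_sumr; apply: eq_bigr => b _.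
  by rewrite maxr_pMr ?ltW// mulr0 mulrBr mulrCA divff// mulr1.
by rewrite !E ler_pM2l// excess_of_majorized.
Qed.

Lemma sum_largest_sorted n (x : 'rV[R]_n) l : (l <= n)%N ->
  (forall i j : 'I_n, (i <= j)%N -> x ord0 j <= x ord0 i) ->
  sum_largest l x = \sum_(i < l) nth 0 (entries x) i.
Proof.
move=> ln xs; rewrite /sum_largest sorted_sort; first last.
- apply: (homo_sorted (e := relpre val leq)) => [i j|]; first exact: xs.
  by rewrite -sorted_map val_enum_ord iota_sorted.
- exact: rev_trans le_trans.
rewrite (big_nth 0) size_takel ?size_entries// big_mkord.
by apply: eq_bigr => i _; rewrite nth_take.
Qed.

End Majorization.

(** * The local criterion *)

Section LocalPerturbation.
Variable R : realType.

(** Lexicographic nonnegativity of the pair [(u, v)]. It uses only [<=], negation and conjunction,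
    the tests of [bexp], so that evaluating [lexge0_exp] computes to it. *)
Definition lexge0 (u v : R) : bool :=
  (0 <= u) && ~~ ((u <= 0) && ~~ (0 <= v)).

Definition lexmax1 (u v : R) : R := if lexge0 u v then u else 0.

Definition lexmax2 (u v : R) : R := if lexge0 u v then v else 0.

Lemma near_lexge0 (u v : R) :
  \forall e \near 0^'+, (0 <= u + e * v) = lexge0 u v.
Proof.
(* The summand 1 keeps the denominator positive when [v = 0]. *)
have v1 : 0 < `|v| + 1 by rewrite ltr_wpDl.
have small (e : R) : 0 < e -> e < `|u| / (`|v| + 1) -> `|e * v| < `|u|.
  move=> e0; rewrite ltr_pdivlMr// => eu; apply: le_lt_trans eu.
  by rewrite normrM gtr0_norm// ler_pM2l// lerDl.
rewrite /lexge0; have [u0|u0|->] := ltgtP u 0.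
- near=> e; apply/negbTE; rewrite -ltNge.
  have : `|e * v| < `|u|.
    apply: small; near: e; first exact: nbhs_right_gt.
    by apply: nbhs_right_lt; rewrite divr_gt0// normr_gt0 lt_eqF.
  by rewrite (ltr0_norm u0) => /ltr_normlP[]; lra.
- near=> e.
  have : `|e * v| < `|u|.
    apply: small; near: e; first exact: nbhs_right_gt.
    by apply: nbhs_right_lt; rewrite divr_gt0// normr_gt0 gt_eqF.
  by rewrite (gtr0_norm u0) => /ltr_normlP[]/=; lra.
- near=> e.
  have e0 : 0 < e by near: e; exact: nbhs_right_gt.
  by rewrite add0r pmulr_rge0//= negbK.
Unshelve. all: by end_near. Qed.

(** For small [e] the positive part is exactly affine in [e], not just to first order, so sums of
    such terms can again be tested by [lexge0]. *)
Lemma near_lexmax (u v : R) :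
  \forall e \near 0^'+,
    Num.max (u + e * v) 0 = lexmax1 u v + e * lexmax2 u v.
Proof.
near=> e; have : (0 <= u + e * v) = lexge0 u v.
  by near: e; exact: near_lexge0.
rewrite /lexmax1 /lexmax2; case: lexge0 => [/max_idPl//|].
by rewrite mulr0 addr0 => /negbT; rewrite -ltNge => /ltW/max_idPr.
Unshelve. all: by end_near. Qed.

(** * Transfer of mass to the next entry *)

Definition transfer_dir (a b : nat) : R := (b == a.+1)%:R - (b == a)%:R.

Definition transfer k (chi : 'rV[R]_k) (a : nat) (e : R) : 'rV[R]_k :=
  \row_b (chi ord0 b + e * transfer_dir a b).

Lemma nth_transfer k (chi : 'rV[R]_k) a e i : (i < k)%N ->
  nth 0 (entries (transfer chi a e)) i =
  nth 0 (entries chi) i + e * transfer_dir a i.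
Proof.
move=> ik; rewrite -[i]/(nat_of_ord (Ordinal ik)) !nth_entries.
by rewrite mxE.
Qed.

(** Only the prefix that contains position [a] but not [a + 1] notices the transfer. *)
Lemma sum_transfer_dir a l :
  \sum_(i < l) transfer_dir a i = - (l == a.+1)%:R.
Proof.
elim: l => [|l IH]; first by rewrite big_ord0 oppr0.
rewrite big_ord_recr IH /transfer_dir /= eqSS.
by rewrite addrA addNr add0r.
Qed.

Lemma sum_transfer k (chi : 'rV[R]_k) a e l : (l <= k)%N ->
  \sum_(i < l) nth 0 (entries (transfer chi a e)) i =
  \sum_(i < l) nth 0 (entries chi) i - e * (l == a.+1)%:R.
Proof.
move=> lk; rewrite -mulrN -sum_transfer_dir mulr_sumr -big_split/=.
by apply: eq_bigr => i _; rewrite nth_transfer// (leq_trans _ lk).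
Qed.

Lemma sum_row k (x : 'rV[R]_k) :
  \sum_i x ord0 i = \sum_(i < k) nth 0 (entries x) i.
Proof. by apply: eq_bigr => i _; rewrite nth_entries. Qed.

Section Transfer.
Variables (k : nat) (chi : 'rV[R]_k) (a : nat) (e : R).
Let c := nth 0 (entries chi).
Hypotheses (chiS : is_state chi) (ak : (a.+1 < k)%N) (e0 : 0 < e).
Hypothesis ec : e <= (c a - c a.+1) / 2.

Let mono i j : (i <= j < k)%N -> c j <= c i.
Proof.
case/andP=> ij jk; have [_ _ +] := chiS.
move=> /(_ (Ordinal (leq_ltn_trans ij jk)) (Ordinal jk) ij).
by rewrite -!nth_entries.
Qed.

Let step_le : c a.+1 + e <= c a - e.
Proof. by move: ec; lra. Qed.

(** The bound [ec] keeps the entries at [a] and [a + 1] ordered; any other two neighbours keep their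
    gap or move apart. *)
Lemma transfer_sorted (i j : 'I_k) : (i <= j)%N ->
  transfer chi a e ord0 j <= transfer chi a e ord0 i.
Proof.
move=> ij; rewrite -!nth_entries !nth_transfer//.
have [ik jk] := (ltn_ord i, ltn_ord j).
move: (nat_of_ord i) (nat_of_ord j) ik jk ij => {}i {}j ik jk ij.
have := @mono i j; rewrite ij jk => /(_ isT) cij.
rewrite -/c /transfer_dir.
have [->|ij'] := eqVneq i j; first by [].
move: cij step_le e0.
have [ja|ja] := eqVneq j a.+1.
  have := @mono i a; rewrite (ltnW ak) andbT => cia.
  subst j; have ia : (i <= a)%N by rewrite -ltnS ltn_neqAle ij' ij.
  have {cia} := cia ia.
  rewrite (negbTE ij') (gtn_eqF (ltnSn a)).
  by have [->|ia'] := eqVneq i a => /=; lra.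
have [ja'|ja'] := eqVneq j a.
  subst j; rewrite (negbTE ij') (ltn_eqF (leq_ltn_trans ij (ltnSn a))) /=.
  by lra.
have [->|ia] := eqVneq i a.+1; first by rewrite gtn_eqF//=; lra.
have [iae|ia'] := eqVneq i a => /=; last by lra.
subst i; have aj : (a.+1 <= j)%N by rewrite ltn_neqAle ij' ij.
have := @mono a.+1 j; rewrite aj jk => /(_ isT); lra.
Qed.

Lemma transfer_state : is_state (transfer chi a e).
Proof.
have [chi0 chi1 _] := chiS; split; last exact: transfer_sorted.
- move=> i; rewrite mxE /transfer_dir.
  have ca : 0 <= c a.+1 by rewrite -[a.+1]/(nat_of_ord (Ordinal ak)) /c
    nth_entries.
  have := chi0 i; rewrite -nth_entries -/c; move: ca step_le e0.
  have [->|ia] := eqVneq (nat_of_ord i) a.+1; first by rewrite gtn_eqF//=; lra.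
  by have [->|ia'] := eqVneq (nat_of_ord i) a => /=; lra.
- rewrite sum_row sum_transfer// -sum_row chi1 gtn_eqF//.
  by rewrite mulr0 subr0.
Qed.

Lemma transfer_neq : chi <> transfer chi a e.
Proof.
move=> /rowP/(_ (Ordinal ak)); rewrite !mxE /transfer_dir /= eqxx gtn_eqF//.
by rewrite subr0 mulr1 -[LHS]addr0 => /addrI/esym/eqP; rewrite gt_eqF.
Qed.

Lemma majorized_transfer : majorized (transfer chi a e) chi.
Proof.
have [_ chi1 chis] := chiS; have [_ tr1 _] := transfer_state.
split; last by rewrite chi1.
move=> l /andP[_ /ltnW lk]; rewrite !sum_largest_sorted//; last first.
  exact: transfer_sorted.
by rewrite sum_transfer// gerBl mulr_ge0// ltW.
Qed.

(** The partial sums of the transfer and of [chi] differ only at length [a + 1], so a slack of [e]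
    at that length is all that [w] needs. *)
Lemma majorized_to_transfer (w : 'rV[R]_k) : is_state w -> majorized w chi ->
  e <= \sum_(i < a.+1) (c i - nth 0 (entries w) i) ->
  majorized w (transfer chi a e).
Proof.
move=> [_ w1 ws] [wchi _] ew; have [_ tr1 _] := transfer_state.
have [_ _ chis] := chiS.
split; last by rewrite w1.
move=> l lk; have := wchi l lk; case/andP: lk => _ /ltnW lk.
rewrite !sum_largest_sorted//; last exact: transfer_sorted.
rewrite sum_transfer//; have [->|_] := eqVneq l a.+1;
  last by rewrite mulr0 subr0.
by move: ew; rewrite sumrB /c/=; lra.
Qed.

End Transfer.

(* The leftmost maximum of [l |-> \sum_(i < l) (chi i - w i)] is at a strict
   descent of [chi]. *)
Lemma exists_descent k (chi w : 'rV[R]_k) :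
  is_state chi -> is_state w -> majorized w chi -> chi <> w ->
  exists a, [/\ (a.+1 < k)%N,
    nth 0 (entries chi) a.+1 < nth 0 (entries chi) a &
    0 < \sum_(i < a.+1) (nth 0 (entries chi) i - nth 0 (entries w) i)].
Proof.
move=> [_ chi1 chis] [_ w1 ws] [wchi _] neq.
set c := nth 0 (entries chi); set v := nth 0 (entries w).
pose D l := \sum_(i < l) (c i - v i).
have D0 : D 0%N = 0 by rewrite /D big_ord0.
have Dk : D k = 0 by rewrite /D sumrB -!sum_row chi1 w1 subrr.
have DS l : D l.+1 = D l + (c l - v l) by rewrite /D big_ord_recr.
have Dge0 l : (l <= k)%N -> 0 <= D l.
  have [->|l0] := eqVneq l 0%N; first by rewrite D0.
  rewrite leq_eqVlt => /predU1P[->|lk]; first by rewrite Dk.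
  have := wchi l; rewrite lt0n l0 lk => /(_ isT).
  rewrite !sum_largest_sorted ?(ltnW lk)//.
  by rewrite /D sumrB subr_ge0.
have [l0 [l0k Dl0]] : exists l, (l <= k)%N /\ 0 < D l.
  apply: contrapT => noD; apply: neq; apply/rowP => i.
  have Deq l : (l <= k)%N -> D l = 0.
    move=> lk; apply/eqP; rewrite eq_le Dge0// andbT leNgt.
    by apply/negP => Dl; apply: noD; exists l.
  have := DS i; rewrite !Deq//; last exact: ltnW.
  by rewrite add0r -!nth_entries => /esym/eqP; rewrite subr_eq0 => /eqP.
(* [P] singles out the maximizers of [D]; minimality among them yields the strict increase
   [D a < D a.+1]. *)
pose P l := (l <= k)%N && [forall m : 'I_k.+1, D m <= D l].
have exP : exists l, P l.
  case: (@arg_maxP _ R 'I_k.+1 ord0 xpredT (fun m => D m)) => // m _ Dm.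
  exists m; rewrite /P -ltnS ltn_ord; apply/forallP => m'; exact: Dm.
case: (ex_minnP exP) => l /andP[lk /forallP Dmax] lmin.
have Dl : 0 < D l by apply: lt_le_trans Dl0 (Dmax (Ordinal (l0k : l0 <
  k.+1)%N)).
case: l => [|a] in lk Dmax lmin Dl *; first by rewrite D0 ltxx in Dl.
have ak : (a.+1 < k)%N.
  rewrite ltn_neqAle lk andbT; apply/eqP => E.
  by rewrite E Dk ltxx in Dl.
have DaS : D a < D a.+1.
  rewrite ltNge; apply/negP => Da.
  have : P a.
    rewrite /P (ltnW lk); apply/forallP => m; exact: le_trans (Dmax m) Da.
  by move/lmin; rewrite ltnn.
have DSS := Dmax (Ordinal (ak : a.+2 < k.+1)%N).
exists a; split => //.
(* Together with [DaS] and [DSS] this gives [c a.+1 <= v a.+1 <= v a < c a]. *)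
have := ws (Ordinal lk) (Ordinal ak) (leqnSn a); rewrite -!nth_entries/=.
move: DaS DSS; rewrite /= !DS -/v; lra.
Qed.

(** * Reduction to finitely many lexicographic tests *)

Section Criterion.
Variables (n k : nat) (psi phi : 'rV[R]_n) (chi : 'rV[R]_k).
Let p := nth 0 (entries psi).
Let q := nth 0 (entries phi).
Let c := nth 0 (entries chi).

(* A quantity [u + e * v] with infinitesimal [e > 0] is encoded by [u] and [v].
   [gap1] and [gap2] encode the difference of the excesses of
   [kron phi (transfer chi a e)] and [kron psi chi] at the threshold given
   by the entry [(i, b)] of the former. *)
Definition gap_term (f : R -> R -> R) (a i b j d : nat) : R :=
  f (q j * c d - q i * c b)
    (q j * transfer_dir a d - q i * transfer_dir a b) -
  f (p j * c d - q i * c b) (0 - q i * transfer_dir a b).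

Definition gap (f : R -> R -> R) (a i b : nat) : R :=
  \sum_(j < n) \sum_(d < k) gap_term f a i b j d.

(** The threshold itself moves with [e], so the [psi] terms have a derivative too. The finitely many
    positive parts are affine for a common range of small [e], hence so is the difference of the
    excesses. *)
Lemma near_gap a (i : 'I_n) (b : 'I_k) :
  \forall e \near 0^'+,
    let t := phi ord0 i * transfer chi a e ord0 b in
    (excess (kron psi chi) t <= excess (kron phi (transfer chi a e)) t) =
    lexge0 (gap lexmax1 a i b) (gap lexmax2 a i b).
Proof.
pose max_eq (u v e : R) := Num.max (u + e * v) 0 = lexmax1 u v + e * lexmax2 u v.
pose P j d e := max_eq (q j * c d - q i * c b)
      (q j * transfer_dir a d - q i * transfer_dir a b) e /\
    max_eq (p j * c d - q i * c b) (0 - q i * transfer_dir a b) e.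
have near_max : \forall e \near 0^'+, forall (j : 'I_n) (d : 'I_k), P j d e.
  apply: filter_forall => j; apply: filter_forall => d.
  by apply: filterI; exact: near_lexmax.
near=> e; have <- : (0 <= gap lexmax1 a i b + e * gap lexmax2 a i b) =
    lexge0 (gap lexmax1 a i b) (gap lexmax2 a i b).
  by near: e; exact: near_lexge0.
have maxE : forall (j : 'I_n) (d : 'I_k), P j d e by near: e; exact: near_max.
rewrite /= -subr_ge0; congr (0 <= _).
set t := _ * _; rewrite /excess.
rewrite (sum_kron _ _ (fun x => Num.max (x - t) 0)).
rewrite (sum_kron _ _ (fun x => Num.max (x - t) 0)).
rewrite -sumrB mulr_sumr -big_split; apply: eq_bigr => j _ /=.
rewrite -sumrB mulr_sumr -big_split; apply: eq_bigr => d _ /=.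
have [E1 E2] := maxE j d.
rewrite /gap_term.
have -> : phi ord0 j * transfer chi a e ord0 d - t =
    q j * c d - q i * c b +
    e * (q j * transfer_dir a d - q i * transfer_dir a b).
  by rewrite /t !mxE -!nth_entries -/q -/c; ring.
have -> : psi ord0 j * chi ord0 d - t =
    p j * c d - q i * c b + e * (0 - q i * transfer_dir a b).
  by rewrite /t !mxE -!nth_entries -/p -/q -/c; ring.
by rewrite E1 E2; ring.
Unshelve. all: by end_near. Qed.

Lemma recoverable_iff : is_state psi -> is_state phi -> is_state chi ->
  recoverable psi phi chi <->
  exists a, [/\ (a.+1 < k)%N, c a.+1 < c a &
    forall (i : 'I_n) (b : 'I_k),
      lexge0 (gap lexmax1 a i b) (gap lexmax2 a i b)].
Proof.
move=> psiS phiS chiS.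
have [psi0 psi1 _] := psiS; have [phi0 phi1 _] := phiS.
pose near_ok a e := forall (i : 'I_n) (b : 'I_k),
    let t := phi ord0 i * transfer chi a e ord0 b in
    (excess (kron psi chi) t <= excess (kron phi (transfer chi a e)) t) =
    lexge0 (gap lexmax1 a i b) (gap lexmax2 a i b).
have near_all a : \forall e \near 0^'+, near_ok a e.
  by apply: filter_forall => i; apply: filter_forall => b; exact: near_gap.
split=> [[w [wS maj wchi neq]]|[a [ak ca lex]]].
- have [a [ak ca Da]] := exists_descent chiS wS wchi neq.
  exists a; split => // i b.
  near (0 : R)^'+ => e.
  have e0 : 0 < e by near: e; exact: nbhs_right_gt.
  have ec : e <= (c a - c a.+1) / 2.
    by near: e; apply: nbhs_right_le; rewrite divr_gt0// subr_gt0.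
  have ok : near_ok a e by near: e; exact: near_all.
  have <- : _ = lexge0 _ _ := ok i b.
  (* The chain runs from [kron psi chi] through [kron phi w] to [kron phi (transfer chi a e)]; the
     positive slack [Da] leaves room for a small [e]. *)
  apply: excess_of_majorized; apply: majorized_trans maj _.
  apply: majorized_kron => //; apply: majorized_to_transfer => //.
  by near: e; exact: nbhs_right_le.
- near (0 : R)^'+ => e.
  have e0 : 0 < e by near: e; exact: nbhs_right_gt.
  have ec : e <= (c a - c a.+1) / 2.
    by near: e; apply: nbhs_right_le; rewrite divr_gt0// subr_gt0.
  have ok : near_ok a e by near: e; exact: near_all.
  have tS := transfer_state chiS ak e0 ec.
  exists (transfer chi a e); split => //.
  + have [_ chi1 _] := chiS; have [_ t1 _] := tS.
    apply: majorized_of_excess.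
      rewrite (sum_kron _ _ id) (sum_kron _ _ id).
      under eq_bigr do rewrite -mulr_sumr chi1 mulr1.
      by under [RHS]eq_bigr do rewrite -mulr_sumr t1 mulr1; rewrite psi1.
    move=> j; have [i [b ->]] := kron_entry phi (transfer chi a e) j.
    by rewrite (ok i b : _ = lexge0 _ _).
  + exact: majorized_transfer.
  + exact: transfer_neq.
Unshelve. all: by end_near. Qed.

End Criterion.

End LocalPerturbation.

(** * The program *)

Section Execution.
Variable R : realType.
Implicit Types s : store R.

(** Bounding the time from above lets branches of different cost share one bound. *)
Definition exec s (c : cmd) (T : nat) s' : Prop :=
  exists2 t, (t <= T)%N & run s c t s'.

Lemma exec_weaken s c T T' s' : (T <= T')%N -> exec s c T s' -> exec s c T' s'.
Proof. by move=> TT' [t tT st]; exists t => //; exact: leq_trans TT'. Qed.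

Lemma exec_skip s : exec s Skip 1 s.
Proof. by exists 1%N => //; exact: RunSkip. Qed.

Lemma exec_seq s1 s2 s3 c1 c2 T1 T2 :
  exec s1 c1 T1 s2 -> exec s2 c2 T2 s3 -> exec s1 (Seq c1 c2) (T1 + T2) s3.
Proof.
move=> [t1 le1 r1] [t2 le2 r2]; exists (t1 + t2)%N; first exact: leq_add.
exact: RunSeq r1 r2.
Qed.

Lemma exec_if s s' b c1 c2 T :
  exec s (if beval s b then c1 else c2) T s' ->
  exec s (If b c1 c2) (bcost b + T) s'.
Proof.
by move=> [t tT r]; exists (bcost b + t)%N; [rewrite leq_add2l|exact: RunIf].
Qed.

(** As [k] is fixed, loops over positions of [chi] are written out in the program text, where these
    positions become literals. *)
Fixpoint unroll (m : nat) (c : nat -> cmd) : cmd :=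
  if m is m'.+1 then Seq (unroll m' c) (c m') else Skip.

Lemma exec_unroll (f : nat -> store R) (c : nat -> cmd) B m :
  (forall b, (b < m)%N -> exec (f b) (c b) B (f b.+1)) ->
  exec (f 0%N) (unroll m c) (m * B).+1 (f m).
Proof.
elim: m => [|m IH] fc; first exact: exec_skip.
rewrite mulSn addnC -addSn; apply: exec_seq (fc m _) => //.
by apply: IH => b bm; apply: fc; exact: ltnW.
Qed.

Definition zero : iexp := IConst 0.

Definition size_exp : iexp := ILoad 0 zero.

Definition incr (v : nat) : cmd :=
  IStore v zero (IAdd (ILoad v zero) (IConst 1)).

(* The counter in array [v] runs from 0 to the input size; it is expected to
   be 0 initially and is reset to 0. *)
Definition for_size (v : nat) (body : cmd) : cmd :=
  Seq (While (BLeI (IAdd (ILoad v zero) (IConst 1)) size_exp)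
         (Seq body (incr v)))
    (IStore v zero zero).

(** The loop invariant is a trajectory: [f i] is the state before iteration [i]. The guard costs 7;
    the final 10 is one failing guard plus the reset of cost 3. *)
Lemma exec_for_size v body B n (f : nat -> store R) s' :
  (forall i, imem (f i) 0 0 = n) -> (forall i, imem (f i) v 0 = i) ->
  (forall i, (i < n)%N -> exec (f i) (Seq body (incr v)) B (f i.+1)) ->
  Store (update (imem (f n)) v 0%N 0%N) (rmem (f n)) = s' ->
  exec (f 0%N) (for_size v body) (n * (7 + B) + 10) s'.
Proof.
move=> fn fv fB <-.
have loop m : (m <= n)%N -> exec (f (n - m)%N)
    (While (BLeI (IAdd (ILoad v zero) (IConst 1)) size_exp)
      (Seq body (incr v))) (m * (7 + B) + 7) (f n).
  elim: m => [|m IH] mn.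
    rewrite subn0; exists 7%N => //; apply: RunWhileEnd.
    by rewrite /= fn fv addn1 ltnn.
  have lt_n : (n - m.+1 < n)%N by rewrite ltn_subrL (leq_trans _ mn).
  have [t1 le1 r1] := fB _ lt_n.
  have [t2 le2 r2] := IH (ltnW mn).
  exists (7 + t1 + t2)%N.
    by rewrite mulSn -[(_ + _ + 7)%N]addnA leq_add// leq_add2l.
  apply: (@RunWhileLoop _ _ (f (n - m)%N)) r2.
    by rewrite /= fn fv addn1 -subSn// subSS leq_subr.
  by rewrite -[(n - m)%N]subSS subSn.
have := loop n (leqnn n); rewrite subnn => h.
rewrite -[10%N]/(7 + 3)%N addnA; apply: exec_seq h _.
by exists 3%N => //; exact: RunIStore.
Qed.

End Execution.

(* Integer arrays 1 and 2 hold loop counters [i] and [j]; real arrays 3 and 4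
   hold the sums [gap lexmax1] and [gap lexmax2], 5 counts the entries [(i, b)]
   at which the test fails, and 6 counts the directions [a] passing it. *)
Definition reg (r : nat) : rexp := RLoad r zero.

Definition set_reg (r : nat) (e : rexp) : cmd := RStore r zero e.

Definition var_i : iexp := ILoad 1 zero.

Definition var_j : iexp := ILoad 2 zero.

Definition lexge0_exp (u v : rexp) : bexp :=
  BAnd (BLeR (RConst 0) u)
    (BNot (BAnd (BLeR u (RConst 0)) (BNot (BLeR (RConst 0) v)))).

Definition dir_exp (a b : nat) : rexp :=
  RSub (RConst (b == a.+1)) (RConst (b == a)).

Definition chi_exp (b : nat) : rexp := RLoad 2 (IConst b).

Definition add_lexmax (op : rexp -> rexp -> rexp) (u v : rexp) : cmd :=
  If (lexge0_exp u v)
    (Seq (set_reg 3 (op (reg 3) u)) (set_reg 4 (op (reg 4) v))) Skip.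

Definition gap_term_cmd (a b d : nat) : cmd :=
  Seq (add_lexmax RAdd
        (RSub (RMul (RLoad 1 var_j) (chi_exp d))
           (RMul (RLoad 1 var_i) (chi_exp b)))
        (RSub (RMul (RLoad 1 var_j) (dir_exp a d))
           (RMul (RLoad 1 var_i) (dir_exp a b))))
      (add_lexmax RSub
        (RSub (RMul (RLoad 0 var_j) (chi_exp d))
           (RMul (RLoad 1 var_i) (chi_exp b)))
        (RSub (RConst 0) (RMul (RLoad 1 var_i) (dir_exp a b)))).

Definition test_cmd (k a b : nat) : cmd :=
  Seq (for_size 2 (unroll k (gap_term_cmd a b)))
    (Seq (If (lexge0_exp (reg 3) (reg 4)) Skip
            (set_reg 5 (RAdd (reg 5) (RConst 1))))
      (Seq (set_reg 3 (RConst 0)) (set_reg 4 (RConst 0)))).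

Definition direction_cmd (k a : nat) : cmd :=
  If (BLeR (chi_exp a) (chi_exp a.+1)) Skip
    (Seq (for_size 1 (unroll k (test_cmd k a)))
      (Seq (If (BLeR (reg 5) (RConst 0))
              (set_reg 6 (RAdd (reg 6) (RConst 1))) Skip)
        (set_reg 5 (RConst 0)))).

(** The answer overwrites the cell holding the input size, so it is written after all loops. *)
Definition recovery_cmd (k : nat) : cmd :=
  Seq (unroll k.-1 (direction_cmd k))
    (If (BLeR (reg 6) (RConst 0)) (IStore 0 zero zero)
       (IStore 0 zero (IConst 1))).

(** The summands are 200 per gap term, 1 for the [Skip] that starts the unrolled loop, 6 for the
    increment and 7 for the guard; 50 covers the rest with slack. *)
Definition test_time (k n : nat) : nat :=
  (n * (7 + ((k * 200).+1 + 6)) + 50)%N.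

Definition recovery_time (k n : nat) : nat :=
  ((k.-1 * (n * (7 + ((k * test_time k n).+1 + 6)) + 50)).+1 + 7)%N.

(** * Execution of the program on inputs *)

Section Correctness.
Variables (R : realType) (n k : nat).
Variables (psi phi : 'rV[R]_n) (chi : 'rV[R]_k).
Let p := nth 0 (entries psi).
Let q := nth 0 (entries phi).
Let c := nth 0 (entries chi).

(** The input arrays never change, so six values determine every state met before the final
    write. *)
Definition regs (i j : nat) (h1 h2 bad good : R) : store R := Store
  (fun a x => match a, x with
              | 0, 0 => n | 1, 0 => i | 2, 0 => j | _, _ => 0 end)%N
  (fun a x => match a, x with
              | 0%N, _ => p x | 1%N, _ => q x | 2%N, _ => c x
              | 3%N, 0%N => h1 | 4%N, 0%N => h2
              | 5%N, 0%N => bad | 6%N, 0%N => good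
              | _, _ => 0
              end).

Lemma input_regs : input psi phi chi = regs 0 0 0 0 0 0.
Proof.
rewrite /input /regs; congr Store; apply/funext => a; apply/funext => x.
  by case: a x => [|[|[|a]]] [|x].
by case: a x => [|[|[|[|[|[|[|a]]]]]]] [|x].
Qed.

Lemma update_i i j h1 h2 bad good i' :
  Store (update (imem (regs i j h1 h2 bad good)) 1 0%N i')
    (rmem (regs i j h1 h2 bad good)) = regs i' j h1 h2 bad good.
Proof.
rewrite /regs /update /=; congr Store; apply/funext => a; apply/funext => x.
by case: a x => [|[|[|a]]] [|x].
Qed.

Lemma update_j i j h1 h2 bad good j' :
  Store (update (imem (regs i j h1 h2 bad good)) 2 0%N j')
    (rmem (regs i j h1 h2 bad good)) = regs i j' h1 h2 bad good.
Proof.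
rewrite /regs /update /=; congr Store; apply/funext => a; apply/funext => x.
by case: a x => [|[|[|a]]] [|x].
Qed.

Lemma exec_incr_i i j h1 h2 bad good :
  exec (regs i j h1 h2 bad good) (incr 1) 6 (regs i.+1 j h1 h2 bad good).
Proof.
exists 6%N => //.
rewrite -(addn1 i) -(update_i i j h1 h2 bad good (i + 1)%N).
exact: RunIStore.
Qed.

Lemma exec_incr_j i j h1 h2 bad good :
  exec (regs i j h1 h2 bad good) (incr 2) 6 (regs i j.+1 h1 h2 bad good).
Proof.
exists 6%N => //.
rewrite -(addn1 j) -(update_j i j h1 h2 bad good (j + 1)%N).
exact: RunIStore.
Qed.

Lemma exec_set_reg i j h1 h2 bad good r e x T : (3 <= r <= 6)%N ->
  reval (regs i j h1 h2 bad good) e = x -> (rcost e + 2 <= T)%N ->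
  exec (regs i j h1 h2 bad good) (set_reg r e) T
    (regs i j (if r == 3 then x else h1) (if r == 4 then x else h2)
       (if r == 5 then x else bad) (if r == 6 then x else good)).
Proof.
move=> r36 <- eT {x}; exists (rcost e + 2)%N => //.
set x := reval _ e; set s := regs i j h1 h2 bad good;
  set s' := regs _ _ _ _ _ _.
suff <- : Store (imem s) (update (rmem s) r 0%N x) = s'.
  by rewrite addnC; exact: RunRStore.
rewrite /s' /regs /update /=; congr Store; apply/funext => a; apply/funext => y.
by case: r r36 @s' => [|[|[|[|[|[|[|r]]]]]]]// _ _;
  case: a y => [|[|[|[|[|[|[|a]]]]]]] [|y].
Qed.

(** The values of [u] and [v] must not depend on registers 3 and 4, since register 3 is already
    overwritten when [v] is read for register 4. *)
Lemma exec_add_lexmax (sg : bool) i j h1 h2 bad good u v U V :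
  (forall g1 g2, reval (regs i j g1 g2 bad good) u = U) ->
  (forall g1 g2, reval (regs i j g1 g2 bad good) v = V) ->
  (rcost u <= 15)%N -> (rcost v <= 15)%N ->
  exec (regs i j h1 h2 bad good) (add_lexmax (if sg then RAdd else RSub) u v)
    100 (regs i j (h1 + (-1) ^+ (~~ sg) * lexmax1 U V)
           (h2 + (-1) ^+ (~~ sg) * lexmax2 U V) bad good).
Proof.
move=> uU vV cu cv.
apply: (@exec_weaken _ _ _ (bcost (lexge0_exp u v) + 40));
  first by rewrite /=; lia.
apply: exec_if; rewrite [beval _ _]/= uU vV -/(lexge0 U V) /lexmax1 /lexmax2.
case: lexge0; last first.
  by rewrite !mulr0 !addr0; exact: exec_weaken (exec_skip _).
apply: (@exec_weaken _ _ _ (20 + 20)) => //.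
apply: (@exec_seq _ _ (regs i j (h1 + (-1) ^+ (~~ sg) * U) h2 bad good)).
  apply: (@exec_set_reg _ _ _ _ _ _ 3) => //.
    by case: (sg) => /=; rewrite uU ?expr0 ?expr1 ?mul1r ?mulN1r.
  by case: (sg) => /=; lia.
apply: (@exec_set_reg _ _ _ _ _ _ 4) => //; last by case: (sg) => /=; lia.
by case: sg => /=; rewrite vV ?expr0 ?expr1 ?mul1r ?mulN1r.
Qed.

Lemma exec_gap_term i j h1 h2 bad good a b d :
  exec (regs i j h1 h2 bad good) (gap_term_cmd a b d) 200
    (regs i j (h1 + gap_term psi phi chi (@lexmax1 R) a i b j d)
       (h2 + gap_term psi phi chi (@lexmax2 R) a i b j d) bad good).
Proof.
pose U := q j * c d - q i * c b.
pose V := q j * transfer_dir R a d - q i * transfer_dir R a b.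
apply: (@exec_weaken _ _ _ (100 + 100)) => //.
apply: (@exec_seq _ _
  (regs i j (h1 + lexmax1 U V) (h2 + lexmax2 U V) bad good)).
  rewrite -[lexmax1 _ _]mul1r -[lexmax2 _ _]mul1r.
  exact: (@exec_add_lexmax true).
rewrite /gap_term !addrA.
rewrite -[- lexmax1 _ _]mulN1r -[- lexmax2 _ _]mulN1r.
exact: (@exec_add_lexmax false).
Qed.

Lemma exec_gap i bad good a b :
  exec (regs i 0 0 0 bad good) (for_size 2 (unroll k (gap_term_cmd a b)))
    (n * (7 + ((k * 200).+1 + 6)) + 10)
    (regs i 0 (gap psi phi chi (@lexmax1 R) a i b)
       (gap psi phi chi (@lexmax2 R) a i b) bad good).
Proof.
pose S f j := \sum_(j' < j) \sum_(d < k) gap_term psi phi chi f a i b j' d.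
(* [f j] holds the sums over the first [j] outer indices; below, [g d] adds the first [d] terms for
   index [j]. *)
pose f j := regs i j (S (@lexmax1 R) j) (S (@lexmax2 R) j) bad good.
have -> : regs i 0 0 0 bad good = f 0%N by rewrite /f /S !big_ord0.
apply: (@exec_for_size _ _ _ _ n f) => // [j jn|]; last exact: update_j.
pose g d := regs i j
  (S (@lexmax1 R) j +
    \sum_(d' < d) gap_term psi phi chi (@lexmax1 R) a i b j d')
  (S (@lexmax2 R) j +
    \sum_(d' < d) gap_term psi phi chi (@lexmax2 R) a i b j d')
  bad good.
apply: exec_seq.
  have -> : f j = g 0%N by rewrite /f /g !big_ord0 !addr0.
  apply: exec_unroll => d dk; rewrite /g !big_ord_recr/=.
  rewrite (addrA (S (@lexmax1 R) j)) (addrA (S (@lexmax2 R) j)).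
  exact: exec_gap_term.
rewrite /f /S !big_ord_recr/=; exact: exec_incr_j.
Qed.

Definition fails (a i b : nat) : bool :=
  ~~ lexge0 (gap psi phi chi (@lexmax1 R) a i b)
       (gap psi phi chi (@lexmax2 R) a i b).

Lemma exec_test i bad good a b :
  exec (regs i 0 0 0 bad good) (test_cmd k a b) (test_time k n)
    (regs i 0 0 0 (bad + (fails a i b)%:R) good).
Proof.
apply: (@exec_weaken _ _ _
  ((n * (7 + ((k * 200).+1 + 6)) + 10) + ((16 + 6) + (3 + 3)))).
  by rewrite /test_time -!addnA leq_add2l.
apply: exec_seq; first exact: exec_gap.
set g1 := gap _ _ _ _ _ _ _; set g2 := gap _ _ _ _ _ _ _.
apply: (@exec_seq _ _ (regs i 0 g1 g2 (bad + (fails a i b)%:R) good)).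
  apply: exec_if; rewrite [beval _ _]/= -/(lexge0 g1 g2) /fails -/g1 -/g2.
  case: lexge0; first by rewrite /= mulr0n addr0;
    exact: exec_weaken (exec_skip _).
  exact: (@exec_set_reg _ _ _ _ _ _ 5).
apply: exec_seq; first exact: (@exec_set_reg _ _ _ _ _ _ 3).
exact: (@exec_set_reg _ _ _ _ _ _ 4).
Qed.

Definition failures (a : nat) : nat :=
  (\sum_(i < n) \sum_(b < k) fails a i b)%N.

Definition passes (a : nat) : bool := (c a.+1 < c a) && (failures a == 0%N).

Lemma exec_direction good a :
  exec (regs 0 0 0 0 0 good) (direction_cmd k a)
    (n * (7 + ((k * test_time k n).+1 + 6)) + 50)
    (regs 0 0 0 0 0 (good + (passes a)%:R)).
Proof.
rewrite /passes ltNge.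
apply: (@exec_weaken _ _ _
  (bcost (BLeR (chi_exp a) (chi_exp a.+1)) +
    ((n * (7 + ((k * test_time k n).+1 + 6)) + 10) + ((4 + 6) + 3)))).
  by rewrite /=; move: (n * _)%N => X; lia.
apply: exec_if; rewrite [beval _ _]/=.
case: (c a <= c a.+1).
  by rewrite /= mulr0n addr0; apply: exec_weaken (exec_skip _);
    rewrite addn_gt0 orbT.
pose S i := (\sum_(i' < i) \sum_(b < k) fails a i' b)%N.
pose f i := regs i 0 0 0 (S i)%:R good.
apply: (@exec_seq _ _ (regs 0 0 0 0 (failures a)%:R good)).
  have -> : regs 0 0 0 0 0 good = f 0%N by rewrite /f /S big_ord0.
  apply: (@exec_for_size _ _ _ _ n f) => // [i ni|]; last exact: update_i.
  pose g b := regs i 0 0 0 (S i + \sum_(b' < b) fails a i b')%N%:R good.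
  apply: exec_seq.
    have -> : f i = g 0%N by rewrite /f /g big_ord0 addn0.
    apply: exec_unroll => b bk;
      rewrite /g big_ord_recr/= addnA [in X in exec _ _ _ X]natrD.
    exact: exec_test.
  rewrite /f /S big_ord_recr/=; exact: exec_incr_i.
set x := good + _.
apply: (@exec_seq _ _ (regs 0 0 0 0 (failures a)%:R x)); last first.
  exact: (@exec_set_reg _ _ _ _ _ _ 5).
apply: (@exec_weaken _ _ _ (4 + 6)) => //; apply: exec_if.
(* The failure count is a natural number cast to [R], so the comparison with 0 tests whether it
   vanishes. *)
rewrite [beval _ _]/= lern0 /x; case: eqP => _.
  exact: (@exec_set_reg _ _ _ _ _ _ 6).
by rewrite /= mulr0n addr0; exact: exec_weaken (exec_skip _).
Qed.

Lemma exec_recovery : exists2 s,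
  exec (input psi phi chi) (recovery_cmd k) (recovery_time k n) s &
  answer s = [exists a : 'I_k.-1, passes a].
Proof.
pose f m := regs 0 0 0 0 0 (\sum_(a < m) passes a)%N%:R.
set s := Store (update (imem (f k.-1)) 0%N 0%N [exists a : 'I_k.-1, passes a])
  (rmem (f k.-1)).
exists s; last by rewrite /answer /=; case: existsP.
rewrite input_regs; have -> : regs 0 0 0 0 0 0 = f 0%N by rewrite /f big_ord0.
apply: exec_seq.
  apply: exec_unroll => a ak; rewrite /f big_ord_recr/= natrD.
  exact: exec_direction.
apply: (@exec_weaken _ _ _ (4 + 3)) => //; apply: exec_if.
rewrite [beval _ _]/= lern0 sum_nat_eq0.
suff -> : [forall (a : 'I_k.-1 | true), (passes a : nat) == 0%N] =
    ~~ [exists a : 'I_k.-1, passes a].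
  by rewrite /s; case: existsP => _ /=; exists 3%N => //; exact: RunIStore.
by rewrite negb_exists; apply: eq_forallb => a; case: passes.
Qed.

End Correctness.

Lemma decides_recovery_cmd (R : realType) (k : nat) :
  decides_recovery R k (recovery_cmd k) (recovery_time k).
Proof.
move=> n psi phi chi psiS phiS chiS _.
have [s [t tT r] ans] := exec_recovery psi phi chi.
exists t, s; split => //; rewrite ans recoverable_iff//.
have noFail a : (failures psi phi chi a == 0%N) =
    [forall i : 'I_n, forall b : 'I_k, ~~ fails psi phi chi a i b].
  rewrite sum_nat_eq0; apply: eq_forallb => i; rewrite sum_nat_eq0.
  by apply: eq_forallb => b; case: fails.
split=> [/existsP[a /andP[ca]]|[a [ak ca lex]]].
  rewrite noFail => /forallP ok; exists a; split => // [|i b].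
    by rewrite -ltn_predRL.
  by have /forallP/(_ b) := ok i; rewrite negbK.
have ak' : (a < k.-1)%N by rewrite ltn_predRL.
apply/existsP; exists (Ordinal ak'); rewrite /passes ca noFail.
by apply/forallP => i; apply/forallP => b; rewrite /fails negbK.
Qed.

(** * Growth of the running time *)

Lemma test_time_le k n : (0 < n)%N -> (test_time k n <= n * (64 + k * 200))%N.
Proof. by rewrite /test_time => n0; nia. Qed.

Lemma recovery_time_le k n : (0 < k)%N -> (0 < n)%N ->
  (recovery_time k n <=
    (k * (64 + k * (64 + k * 200)) + 8) * n ^ (2 * k - 2))%N.
Proof.
(* For [k = 1] there are no directions: the time is constant, matching the exponent 0. *)
case: k => // -[|m] _ n0; first by rewrite /recovery_time; nia.
(* Now [k >= 2], so the exponent is at least 2 and a quadratic bound suffices. *)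
set k := m.+2; have -> : (2 * k - 2 = m.*2 + 2)%N by rewrite /k; lia.
rewrite expnD; have e0 : (0 < n ^ m.*2)%N by rewrite expn_gt0 n0.
set A := (64 + k * 200)%N.
have tA : (k * test_time k n <= n * (k * A))%N.
  by rewrite mulnCA leq_mul2l test_time_le ?orbT.
have time2 : (recovery_time k n <= (k * (64 + k * A) + 8) * n ^ 2)%N.
  rewrite /recovery_time; move: (k * test_time k n)%N (k * A)%N tA => t B tB.
  have loop : (n * (7 + (t.+1 + 6)) + 50 <= n ^ 2 * (64 + B))%N by nia.
  have : (k.-1 * (n * (7 + (t.+1 + 6)) + 50) <= k * (n ^ 2 * (64 + B)))%N.
    by rewrite leq_mul// leq_pred.
  have : (0 < n ^ 2)%N by rewrite expn_gt0 n0.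
  by nia.
apply: leq_trans time2 _; rewrite leq_mul2l.
by rewrite leq_pmull ?orbT.
Qed.

Theorem theorem5p1 (R : realType) (k : nat) (hk : (0 < k)%N) :
  exists (c : cmd) (T : nat -> nat),
    decides_recovery R k c T /\
    (fun n : nat => (T n)%:R : R^o) =O_\oo
      (fun n : nat => n%:R ^+ (2 * k - 1) * log2 n%:R : R^o).
Proof.
exists (recovery_cmd k), (recovery_time k).
split; first exact: decides_recovery_cmd.
set C := (k * (64 + k * (64 + k * 200)) + 8)%N.
apply/eqOP; near=> M; near=> n.
(* From [n = 2] on the logarithm is at least 1, so it and the spare factor [n] only enlarge the
   right-hand side. *)
have n2 : (2 <= n)%N by near: n; exists 2%N.
have n1 : (1 <= n%:R :> R) by rewrite ler1n; exact: ltnW.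
have log1 : 1 <= log2 (n%:R : R).
  have ln2 : 0 < ln (2 : R) by rewrite ln_gt0// ltr1n.
  rewrite /log2 ler_pdivlMr// mul1r ler_ln ?posrE ?ltr0n ?ler_nat//.
  exact: ltnW.
have CM : C%:R <= M by near: M; exact: nbhs_pinfty_ge.
have pow0 m : 0 <= n%:R ^+ m :> R by rewrite exprn_ge0.
rewrite ger0_norm// [X in _ * X]ger0_norm; last first.
  by rewrite mulr_ge0// (le_trans ler01).
apply: (@le_trans _ _ (C%:R * n%:R ^+ (2 * k - 2))).
  by rewrite -natrX -natrM ler_nat recovery_time_le// ltnW.
rewrite ler_pM//= -[leLHS]mulr1 ler_pM//.
by rewrite ler_weXn2l// leq_sub2l.
Unshelve. all: by end_near. Qed.
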